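(* For every integer $n\ge2$, $$\mathcal C_n^{\mathrm{nd}}=\mathcal C_n\setminus\{\mathbf1\mathbf1^T\}.$$ Equivalently, the all-ones matrix is the unique matrix in $\mathcal C_n$ having a constant row.
   Context: $\mathcal C_n$ is the set of real symmetric positive semidefinite $n\times n$ matrices with unit diagonal, and $\mathcal C_n^{\mathrm{nd}}$ is the set of $P\in\mathcal C_n$ all of whose rows are nonconstant. $\mathbf1\in\mathbb R^n$ is the all-ones column vector. *)

(* Defs.v *)
From HB Require Import structures.
From mathcomp Require Import all_boot all_order all_algebra.
From mathcomp Require Import classical_sets reals.

Set Implicit Arguments.
Unset Strict Implicit.
Unset Printing Implicit Defensive.

Import Order.TTheory GRing.Theory Num.Theory.

Local Open Scope ring_scope.
Local Open Scope classical_set_scope.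

Definition psdmx (R : realType) (n : nat) (P : 'M[R]_n) : Prop :=
  P \is symmetricmx /\ forall x : 'cV[R]_n, 0 <= (x^T *m P *m x) 0 0.

Definition corr_mx (R : realType) (n : nat) : set 'M[R]_n :=
  [set P | psdmx P /\ forall i : 'I_n, P i i = 1].
Arguments corr_mx : clear implicits.

Definition constant_row (R : realType) (n : nat) (P : 'M[R]_n) (i : 'I_n) :
    Prop :=
  exists c : R, row i P = const_mx c.

Definition corr_mx_nd (R : realType) (n : nat) : set 'M[R]_n :=
  [set P | corr_mx R n P /\ forall i : 'I_n, ~ constant_row P i].
Arguments corr_mx_nd : clear implicits.

Definition ones (R : realType) (n : nat) : 'cV[R]_n := const_mx 1.
Arguments ones : clear implicits.

(* Main.v *)
Require Import Defs.
From HB Require Import structures.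
From mathcomp Require Import all_boot all_order all_algebra.
From mathcomp Require Import classical_sets reals.
From mathcomp Require Import ring lra.

Set Implicit Arguments.
Unset Strict Implicit.
Unset Printing Implicit Defensive.

Import Order.TTheory GRing.Theory Num.Theory.

Local Open Scope ring_scope.
Local Open Scope classical_set_scope.

(** A constant row of a correlation matrix contains the diagonal entry 1, so it
    consists of ones.  If row [i] is such a row, then the vector [e_i - e_j] is
    isotropic for the quadratic form of [P], since
    [P i i - P i j - P j i + P j j = 1 - 1 - 1 + 1 = 0].  A positive
    semidefinite form vanishes only on its kernel ([psdmx_isotropic]), so [P]
    does not distinguish the indices [i] and [j]: row [j] is also a row of ones
    ([corr_mx_entry1]).  This holds for every [j], and therefore [P] is the
    all-ones matrix ([corr_mx_constant_row]).  In the other direction, the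
    all-ones matrix is the Gram matrix of [n] copies of the number 1. *)

Section PositiveSemidefinite.
Variables (R : realType) (n : nat).
Implicit Types (P : 'M[R]_n) (x y : 'cV[R]_n).

Lemma symmetricmxP P : reflect (P = P^T) (P \is symmetricmx).
Proof.
by rewrite is_hermitianmxE expr0 scale1r map_mx_id //; exact: eqP.
Qed.

(** Equality case of the Cauchy-Schwarz inequality.  If [y^T P x] were nonzero,
    the form would be negative at a combination of [x] and [y] with a large
    coefficient on [x], because the square term in [x] is absent. *)
Lemma psdmx_isotropic P x :
  psdmx P -> (x^T *m P *m x) 0 0 = 0 -> P *m x = 0.
Proof.
move=> [/symmetricmxP symP psdP] x0.
have a0 y : (y^T *m P *m x) 0 0 = 0.
  set a := (y^T *m P *m x) 0 0; set b := (y^T *m P *m y) 0 0.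
  have b0 : 0 <= b by exact: psdP.
  have xy : (x^T *m P *m y) 0 0 = a.
    by rewrite -[x^T *m P *m y]trmxK [LHS]mxE !trmx_mul trmxK -symP mulmxA.
  (* The coefficients make the value of the form [- a ^+ 2 * (b + 2)] without
     any division; the [+ 1] covers the case [b = 0]. *)
  have := psdP (a *: y - (b + 1) *: x).
  have -> : ((a *: y - (b + 1) *: x)^T *m P *m (a *: y - (b + 1) *: x)) 0 0
            = - (a ^+ 2 * (b + 2)).
    have -> : (a *: y - (b + 1) *: x)^T = a *: y^T - (b + 1) *: x^T.
      by apply/rowP => k; rewrite !mxE.
    have entryB (A B : 'M[R]_1) : (A - B) 0 0 = A 0 0 - B 0 0 by rewrite !mxE.
    have entryZ c (A : 'M[R]_1) : (c *: A) 0 0 = c * A 0 0 by rewrite mxE.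
    rewrite !mulmxBl !mulmxBr -!scalemxAl -!scalemxAr !(entryB, entryZ).
    by rewrite xy x0 -/a -/b; ring.
  rewrite oppr_ge0 pmulr_lle0; last by lra.
  by move=> a2; apply/eqP; rewrite -sqrf_eq0 eq_le a2 sqr_ge0.
apply/colP => k; rewrite [RHS]mxE -(a0 (delta_mx k 0)).
by rewrite trmx_delta -mulmxA -rowE [RHS]mxE.
Qed.

(** An entry equal to 1 means that two unit vectors of a Gram representation
    have inner product 1, which makes them equal. *)
Lemma corr_mx_entry1 P (i j : 'I_n) :
  corr_mx R n P -> P i j = 1 -> row i P = row j P.
Proof.
move=> [psdP diagP] Pij; have [/symmetricmxP symP _] := psdP.
have Pji : P j i = 1 by rewrite symP mxE.
pose x : 'cV[R]_n := delta_mx i 0 - delta_mx j 0.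
have Px : P *m x = col i P - col j P by rewrite mulmxBr -!colE.
have : P *m x = 0.
  apply: psdmx_isotropic => //.
  have -> : x^T = delta_mx 0 i - delta_mx 0 j by rewrite linearB /= !trmx_delta.
  rewrite -mulmxA Px mulmxBl -!rowE !mxE.
  by rewrite !diagP Pij Pji; ring.
rewrite Px => /eqP; rewrite subr_eq0 => /eqP /(congr1 trmx).
by rewrite !tr_col -symP.
Qed.

Lemma ones_mulmx_trE (i j : 'I_n) : (ones R n *m (ones R n)^T) i j = 1.
Proof. by rewrite mxE big_ord1 !mxE mulr1. Qed.

Lemma constant_row_ones (i : 'I_n) :
  constant_row (ones R n *m (ones R n)^T) i.
Proof. by exists 1; apply/rowP => j; rewrite mxE ones_mulmx_trE mxE. Qed.

Lemma corr_mx_ones : corr_mx R n (ones R n *m (ones R n)^T).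
Proof.
split=> [|i]; last exact: ones_mulmx_trE.
split=> [|x]; first by apply/symmetricmxP; rewrite trmx_mul trmxK.
(* The form at [x] is the square of the sum of the entries of [x]. *)
have -> : x^T *m (ones R n *m (ones R n)^T) *m x
          = ((ones R n)^T *m x)^T *m ((ones R n)^T *m x).
  by rewrite trmx_mul trmxK !mulmxA.
by rewrite mxE big_ord1 [X in X * _]mxE -expr2 sqr_ge0.
Qed.

Lemma corr_mx_constant_row P (i : 'I_n) :
  corr_mx R n P -> constant_row P i -> P = ones R n *m (ones R n)^T.
Proof.
move=> corrP [c rowc]; have [_ diagP] := corrP.
have Pc k : P i k = c by move/rowP: rowc => /(_ k); rewrite !mxE.
have Pi k : P i k = 1 by rewrite Pc -(Pc i) diagP.
apply/matrixP => j k; rewrite ones_mulmx_trE -(Pi k).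
by have /rowP/(_ k) := corr_mx_entry1 corrP (Pi j); rewrite !mxE => ->.
Qed.

End PositiveSemidefinite.

Theorem proposition4 (R : realType) (n : nat) (hn : (2 <= n)%N) :
  corr_mx_nd R n = corr_mx R n `\` [set ones R n *m (ones R n)^T] /\
  unique (fun P : 'M[R]_n => corr_mx R n P /\ exists i : 'I_n, constant_row P i)
    (ones R n *m (ones R n)^T).
Proof.
split; last first.
  split=> [|P [corrP [i Pi]]]; last exact/esym/(corr_mx_constant_row corrP Pi).
  split; first exact: corr_mx_ones.
  by exists (Ordinal (ltnW hn)); exact: constant_row_ones.
apply/seteqP; split=> P [corrP ndP]; split=> //.
  move=> /= P1; apply: (ndP (Ordinal (ltnW hn))).
  by rewrite P1; exact: constant_row_ones.
by move=> i Pi; exact/ndP/(corr_mx_constant_row corrP Pi).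
Qed.
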